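(* Let $A$ be a finite nonempty subset of an infinite abelian group $\Gamma$. For integers $s\geq 2$ and $t\geq 1$, there is a graph $G$ with a $\Gamma$-labelling $\gamma$ such that - for every set of $s$ cycles of $G$ whose $\gamma$-values are in $A$, there is a vertex that belongs to all of the $s$ cycles, and - there is no hitting set of size at most $t$ for the set of all cycles of $G$ whose $\gamma$-values are in $A$.
   Context: All graphs are undirected and simple. A $\Gamma$-labelling of a graph $G$ is a function $\gamma\colon E(G)\to\Gamma$, and the $\gamma$-value of a subgraph $H$ is $\gamma(H)=\sum_{e\in E(H)}\gamma(e)$. A hitting set for a set of cycles is a set of vertices meeting every cycle in the set. *)

(* Defs.v *)
From mathcomp Require Import all_boot all_algebra.
From mathcomp Require Import classical_sets cardinality.

Set Implicit Arguments.
Unset Strict Implicit.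
Unset Printing Implicit Defensive.

Import GRing.Theory.
Local Open Scope ring_scope.
Local Open Scope set_scope.

Record sgraph := SGraph {
  vertex :> finType;
  adj : rel vertex;
  adj_sym : symmetric adj;
  adj_irr : irreflexive adj
}.

Definition edge_set (G : sgraph) : {set {set G}} :=
  [set [set x; y] | x in G, y in adj x].

Definition edge (G : sgraph) : finType := {e : {set G} | e \in edge_set G}.

Definition labelling (Gamma : zmodType) (G : sgraph) : Type := edge G -> Gamma.

(* A subgraph without isolated vertices, in particular a cycle, is represented
   by its set of edges, so that two cycles are equal exactly when they are equal
   as subgraphs, whatever the starting vertex and the orientation. *)
Definition vertices_of (G : sgraph) (C : {set edge G}) : {set G} :=
  \bigcup_(e in C) val e.

Definition is_cycle (G : sgraph) (C : {set edge G}) : Prop :=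
  exists c : seq G,
    [/\ (2 < size c)%N, ucycle (@adj G) c
      & val @: C = [set [set x; next c x] | x in c]].

Definition value (Gamma : zmodType) (G : sgraph) (gamma : labelling Gamma G)
    (C : {set edge G}) : Gamma :=
  \sum_(e in C) gamma e.

Definition A_cycle (Gamma : zmodType) (A : set Gamma) (G : sgraph)
    (gamma : labelling Gamma G) (C : {set edge G}) : Prop :=
  is_cycle C /\ A (value gamma C).

Definition hitting_set (G : sgraph) (P : {set edge G} -> Prop) (X : {set G})
    : Prop :=
  forall C : {set edge G}, P C -> exists2 v : G, v \in X & v \in vertices_of C.

(* Main.v *)
(** Take N = ts + 1 edge-disjoint cycles indexed by {0, ..., N - 1}: for every
    set B of at most s indices there is a vertex shared by exactly the cycles
    with index in B, and these shared vertices are separated by private ones.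
    Then any s of the cycles have a common vertex, while t vertices meet at most
    ts < N of them.  Fix a in A.  On each cycle all labels but one are chosen
    generically, and the last one makes the cycle have value a.  A set of edges
    containing none of the N cycles has as value a multiple of a plus a signed
    sum of generic labels that is nonempty unless the set is, so it avoids the
    finite set A; and a cycle containing one of the N cycles is equal to it.
    Hence the N cycles are exactly the cycles with value in A. *)

Require Import Defs.
From mathcomp Require Import all_boot all_algebra.
From mathcomp Require Import boolp classical_sets cardinality.

Import GRing.Theory.
Local Open Scope set_scope.

(** * Cycles as sets of edges *)

Definition cycle_edges {T : finType} (c : seq T) : {set {set T}} :=
  [set [set x; next c x] | x in c].

Lemma cycle_edges_neq0 {T : finType} (c : seq T) :
  (0 < size c)%N -> cycle_edges c != finset.set0.
Proof.
case: c => // x s _; apply/set0Pn; exists [set x; next (x :: s) x].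
by apply/imsetP; exists x; rewrite ?mem_head.
Qed.

Lemma next_neq {T : eqType} (c : seq T) (x : T) :
  uniq c -> (1 < size c)%N -> x \in c -> next c x != x.
Proof.
move=> Uc sc xc; have [i s Ds] := rot_to xc.
move: sc; rewrite -(next_rot i Uc) -(size_rot i) Ds.
move: Uc; rewrite -(rot_uniq i) Ds.
by case: s {Ds} => [|y s] //=; rewrite inE negb_or eqxx eq_sym => /andP[/andP[]].
Qed.

Lemma next_next_neq {T : eqType} (c : seq T) (x : T) :
  uniq c -> (2 < size c)%N -> x \in c -> next c (next c x) != x.
Proof.
move=> Uc sc xc; have [i s Ds] := rot_to xc.
move: sc; rewrite -!(next_rot i Uc) -(size_rot i) Ds.
move: Uc; rewrite -(rot_uniq i) Ds.
case: s {Ds} => [|y [|z s]] //=; rewrite !inE !negb_or eqxx.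
by case/and3P=> /and3P[xy xz _] _ _ _; rewrite [y == x]eq_sym (negbTE xy) eqxx eq_sym.
Qed.

Lemma mem_cycle_edges {T : finType} (c : seq T) (x y : T) : uniq c -> x != y ->
  ([set x; y] \in cycle_edges c) =
  (x \in c) && ((y == next c x) || (y == prev c x)).
Proof.
move=> Uc xy; apply/imsetP/andP => [[z zc Exy]|[xc /orP[]/eqP->]]; first last.
- by exists (prev c x); rewrite ?mem_prev // next_prev // finset.setUC.
- by exists x.
have: x \in [set z; next c z] by rewrite -Exy set21.
have: y \in [set z; next c z] by rewrite -Exy set22.
case/set2P=> Ey /set2P[] Ex; move: xy; rewrite Ex Ey ?eqxx // => _.
by rewrite mem_next prev_next // eqxx orbT.
Qed.

(* Every vertex of a cycle lies on exactly two of its edges, so the vertex set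
   of the smaller cycle is closed under taking successors in the larger one. *)
Lemma cycle_edges_subset {T : finType} (c d : seq T) :
  uniq c -> uniq d -> (2 < size c)%N ->
  cycle_edges c \subset cycle_edges d -> cycle_edges c = cycle_edges d.
Proof.
move=> Uc Ud sc /fintype.subsetP cd.
have nbr x y : x \in c -> y \in [:: next c x; prev c x] ->
    (x \in d) && (y \in [:: next d x; prev d x]).
  move=> xc; rewrite !inE => yx.
  have xy: x != y.
    case/orP: yx => /eqP->; first by rewrite eq_sym next_neq ?(ltnW sc).
    by rewrite -{1}(next_prev Uc x) next_neq ?mem_prev ?(ltnW sc).
  by rewrite -mem_cycle_edges // cd // mem_cycle_edges // xc.
have next_d x : x \in c -> next d x \in [:: next c x; prev c x].
  move=> xc; have /andP[_] := nbr _ _ xc (mem_head _ _).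
  have: prev c x \in [:: next c x; prev c x] by rewrite mem_seq2 eqxx orbT.
  move/(nbr _ _ xc)/andP=> [_]; rewrite !inE.
  (* Two distinct neighbours on [c] exhaust the two neighbours of [x] on [d]. *)
  have: next c x != prev c x.
    rewrite -{1}(next_prev Uc x) next_next_neq ?mem_prev //.
  case: (eqVneq (next d x) (next c x)) => //= _.
  case: (eqVneq (next d x) (prev c x)) => //= _ np /eqP Ep /eqP En.
  by rewrite Ep En eqxx in np.
have next_dc x : x \in c -> next d x \in c.
  by move=> xc; have := next_d x xc; rewrite !inE => /orP[]/eqP->;
     rewrite ?mem_next ?mem_prev.
have dc x : x \in d -> x \in c.
  have [x0 x0c] : exists x0, x0 \in c.
    by case: (c) sc => // x0 s _; exists x0; rewrite mem_head.
  have /andP[x0d _] := nbr _ _ x0c (mem_head _ _).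
  (* All of [d] is a single orbit of [next d], so a nonempty part of it closed under [next d] is
     everything. *)
  rewrite -(fconnect_cycle (cycle_next Ud) x0d) => /iter_findex <-.
  by elim: (findex _ _ _) => //= n; apply: next_dc.
apply/eqP; rewrite finset.eqEsubset; apply/andP; split; apply/fintype.subsetP => // e.
case/imsetP=> x xd ->; have xc := dc x xd; have xN := next_d x xc.
rewrite mem_cycle_edges // ?xc -?in_cons -?mem_seq2 //.
have sd: (1 < size d)%N.
  apply: leq_trans (ltnW sc) _; apply: uniq_leq_size => // y yc.
  by have /andP[] := nbr _ _ yc (mem_head _ _).
by rewrite eq_sym next_neq.
Qed.

(** * Generic labels in an infinite group *)

Lemma infinite_notin {T : eqType} (s : seq T) :
  infinite_set [set: T]%classic -> exists x, x \notin s.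
Proof.
move=> Tinf; apply: contrapT => nx; apply: Tinf.
apply: sub_finite_set (finite_seq s) => x _ /=.
by apply/negPn/negP => xs; apply: nx; exists x.
Qed.

(** Labels are chosen one at a time. The finite list [S] of attainable sums is carried along so that
    each new label has only finitely many values to avoid. *)
Lemma exists_generic_labels {Gamma : zmodType} {E : eqType} (B : seq Gamma)
    (l : seq E) :
  infinite_set [set: Gamma]%classic -> uniq l ->
  exists (x : E -> Gamma) (S : seq Gamma), forall c : E -> int,
    (forall e, c e \in [:: -1; 0; 1]%R) ->
    let v := (\sum_(e <- l) x e *~ c e)%R in
    v \in S /\ (has (fun e => c e != 0%R) l -> v \notin B).
Proof.
move=> Ginf; elim: l => [|e l IH] /=.
  by exists (fun=> 0%R), [:: 0%R] => c _; rewrite big_nil inE.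
case/andP=> el /IH[x [S xS]].
(* If [g + v] or [- g + v] were some [b] in [B], then [g] would be one of these differences. *)
have [g] := infinite_notin ([seq (b - v)%R | b <- B, v <- S] ++
                            [seq (v - b)%R | v <- S, b <- B]) Ginf.
rewrite mem_cat negb_or => /andP[gB gS].
exists (fun e' => if e' == e then g else x e').
exists (S ++ [seq (g + v)%R | v <- S] ++ [seq (- g + v)%R | v <- S]) => c cP.
rewrite big_cons eqxx (eq_big_seq (fun e' => (x e' *~ c e')%R)); last first.
  by move=> e' el'; case: eqP => // Ee; rewrite -Ee el' in el.
have [] := xS c cP; set v := bigop.body _ _ _ => vS vB.
rewrite !mem_cat; have := cP e; rewrite !inE => /or3P[]/eqP->.
- rewrite mulrNz mulr1z map_f ?orbT //; split=> // _; apply: contra gS => bB.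
  by apply/allpairsP; exists (v, (- g + v)%R); rewrite /= opprD opprK addrCA subrr addr0.
- by rewrite mulr0z add0r vS eqxx.
- rewrite mulr1z map_f ?orbT //; split=> // _; apply: contra gB => bB.
  by apply/allpairsP; exists ((g + v)%R, v); rewrite /= addrK.
Qed.

(* On each fibre of [f] the representative [r i] carries no generic label of its
   own: its label is fixed by the requirement that the fibre sums to [a]. *)
Lemma exists_blockwise_labelling {Gamma : zmodType} (A : set Gamma) (a : Gamma)
    {E I : finType} (f : E -> I) (r : I -> E) :
  infinite_set [set: Gamma]%classic -> finite_set A -> cancel r f ->
  exists gamma : E -> Gamma,
    (forall i, (\sum_(e | f e == i) gamma e)%R = a) /\
    (forall D : {set E}, D != finset.set0 ->
       (forall i, exists2 e, f e = i & e \notin D) ->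
       ~ A (\sum_(e in D) gamma e)%R).
Proof.
move=> Ginf /finite_seqP[B ->] rK.
(* The multiple [a *+ k] counts the representatives in a set of edges, hence [k <= #|I|]. *)
have [x [S xS]] := exists_generic_labels
  [seq (b - a *+ k)%R | b <- B, k <- iota 0 #|I|.+1] (enum E) Ginf (enum_uniq E).
pose gamma e : Gamma :=
  (x e + if e == r (f e) then a - \sum_(e' | f e' == f e) x e' else 0)%R.
(* The coefficient of [x e] in the value of [D]: [e] itself adds it, and the representative of its
   fibre subtracts it. For a representative the two cancel. *)
pose c (D : {set E}) e : int := ((e \in D)%:Z - (r (f e) \in D)%:Z)%R.
have sum_gamma (D : {set E}) : (\sum_(e in D) gamma e =
    \sum_e x e *~ c D e + a *+ #|[set i | r i \in D]|)%R.
  have -> : (\sum_e x e *~ c D e = \sum_(e in D) x e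
      - \sum_(i | r i \in D) \sum_(e | f e == i) x e)%R.
    rewrite (exchange_big_dep xpredT) //= [(\sum_(e in D) x e)%R] big_mkcond -sumrB.
    apply: eq_bigr => e _; rewrite mulrzBr; congr (_ - _)%R; first by case: (e \in D).
    rewrite (eq_bigl (fun i => (i == f e) && (r (f e) \in D))); last first.
      by move=> i; rewrite andbC eq_sym; case: eqP => // ->.
    by rewrite big_mkcondr big_pred1_eq; case: (_ \in D).
  rewrite big_split /= -big_mkcondr /= -addrA; congr (_ + _)%R.
  rewrite (reindex_onto r f) /=; last by move=> e /andP[_ /eqP].
  rewrite (eq_bigl (fun i => r i \in D)); last by move=> i; rewrite rK !eqxx !andbT.
  rewrite sumrB sumr_const addrC cardsE; congr (_ - _)%R.
  by apply: eq_bigr => i _; apply: eq_bigl => e; rewrite rK.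
exists gamma; split=> [i|D D0 Dsmall].
  transitivity (\sum_(e in [set e | f e == i]) gamma e)%R.
    by apply: eq_bigl => e; rewrite inE.
  (* On a whole fibre all coefficients cancel and exactly one representative is counted. *)
  rewrite sum_gamma big1 ?add0r.
    rewrite (_ : [set _ | _] = [set i]) ?cards1 //.
    by apply/setP => j; rewrite !inE rK.
  by move=> e _; rewrite /c !inE rK subrr mulr0z.
have cP e : c D e \in [:: -1; 0; 1]%R.
  by rewrite /c; case: (e \in D); case: (_ \in D).
have [_] := xS (c D) cP; rewrite big_enum => xB DB.
have /xB/negP[] : has (fun e => c D e != 0%R) (enum E).
  have [e eD] := set0Pn _ D0; have [e' fe' e'D] := Dsmall (f e).
  (* In a fibre that [D] meets but does not contain, a missing element has coefficient -1 if the
     representative is in [D]; otherwise a present one has coefficient 1. *)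
  apply/hasP; have [rD|rD] := boolP (r (f e) \in D).
    by exists e'; rewrite ?mem_enum // /c fe' rD (negbTE e'D).
  by exists e; rewrite ?mem_enum // /c eD (negbTE rD).
apply/allpairsP; exists ((\sum_(e in D) gamma e)%R, #|[set i | r i \in D]|).
by split; [exact: DB | rewrite mem_iota ltnS max_card | rewrite [_.1]sum_gamma addrK].
Qed.

(** * The union of edge-disjoint cycles *)

Definition cycles_adj {V I : finType} (c : I -> seq V) : rel V :=
  fun x y => (x != y) && [exists i, [set x; y] \in cycle_edges (c i)].

Lemma cycles_adj_sym {V I : finType} (c : I -> seq V) : symmetric (cycles_adj c).
Proof. by move=> x y; rewrite /cycles_adj eq_sym finset.setUC. Qed.

(** The condition [x != y] makes this hold for arbitrary [c]: a sequence of length one yields a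
    singleton as its edge. *)
Lemma cycles_adj_irr {V I : finType} (c : I -> seq V) : irreflexive (cycles_adj c).
Proof. by move=> x; rewrite /cycles_adj eqxx. Qed.

Definition cycles_graph {V I : finType} (c : I -> seq V) : sgraph :=
  SGraph (@cycles_adj_sym V I c) (@cycles_adj_irr V I c).

Definition edges_of {V I : finType} (c : I -> seq V) (i : I) :
    {set edge (cycles_graph c)} :=
  [set e | val e \in cycle_edges (c i)].

Section EdgeDisjointCycles.

Context {V I : finType} (c : I -> seq V).
Hypothesis c_uniq : forall i, uniq (c i).
Hypothesis c_size : forall i, (2 < size (c i))%N.
Hypothesis c_disj : forall i j e,
  e \in cycle_edges (c i) -> e \in cycle_edges (c j) -> i = j.

Let G := cycles_graph c.

Lemma cycles_adj_next i x : x \in c i -> @adj G x (next (c i) x).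
Proof.
move=> xc; rewrite /= /cycles_adj eq_sym next_neq ?(ltnW (c_size i)) //=.
by apply/existsP; exists i; apply/imsetP; exists x.
Qed.

Lemma val_edges_of i : val @: edges_of c i = cycle_edges (c i).
Proof.
apply/setP => e; apply/imsetP/idP => [[e' + ->]|ec]; first by rewrite inE.
have eE : e \in edge_set G.
  have /imsetP[x xc ->] := ec; apply/imset2P.
  by exists x (next (c i) x); rewrite //; exact: cycles_adj_next.
by exists (Sub e eE : edge G); rewrite ?inE.
Qed.

Lemma edges_of_cycle i : is_cycle (edges_of c i).
Proof.
exists (c i); split=> //; last exact: val_edges_of.
by rewrite /ucycle c_uniq andbT; apply: cycle_from_next => // x; apply: cycles_adj_next.
Qed.

Lemma mem_vertices_of_edges_of i (v : G) :
  (v \in vertices_of (edges_of c i)) = (v \in c i).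
Proof.
apply/bigcupP/idP => [[e]|vc].
  by rewrite inE => /imsetP[x xc ->] /set2P[]->; rewrite ?mem_next.
have: [set v; next (c i) v] \in val @: edges_of c i.
  by rewrite val_edges_of; apply/imsetP; exists v.
by case/imsetP=> e ei Ee; exists e; rewrite // -Ee set21.
Qed.

Lemma edges_of_inj : injective (edges_of c).
Proof.
move=> i j Eij.
have /set0Pn[e ei]: cycle_edges (c i) != finset.set0.
  by rewrite cycle_edges_neq0 // (ltn_trans _ (c_size i)).
by apply: c_disj (ei) _; rewrite -val_edges_of -Eij val_edges_of.
Qed.

Lemma edges_of_maximal i (C : {set edge G}) :
  is_cycle C -> edges_of c i \subset C -> C = edges_of c i.
Proof.
case=> d [_ /andP[_ Ud]]; rewrite -/(cycle_edges d) => vC iC; apply: (imset_inj val_inj).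
rewrite val_edges_of vC; apply/esym/cycle_edges_subset => //.
by rewrite -vC -val_edges_of imsetS.
Qed.

Lemma exists_cycles_labelling {Gamma : zmodType} (A : set Gamma) :
  infinite_set [set: Gamma]%classic -> finite_set A -> nonempty A ->
  exists gamma : labelling Gamma G,
    forall C, A_cycle A gamma C <-> exists i, C = edges_of c i.
Proof.
move=> Ginf Afin [a Aa].
(* By disjointness the fibres of [f] are exactly the edge sets of the given cycles. *)
have [f fP] : exists f : edge G -> I, forall e, val e \in cycle_edges (c (f e)).
  apply: (@fin_all_exists _ _ (fun e i => val e \in cycle_edges (c i))) => -[e eE] /=.
  by by case/imset2P: eE => x y _ /andP[_ /existsP[i xy]] ->; exists i.
have fE e i : (f e == i) = (e \in edges_of c i).
  rewrite inE; apply/eqP/idP => [<- //|]; exact: c_disj.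
have [r rK] : exists r : I -> edge G, cancel r f.
  apply: (@fin_all_exists _ _ (fun i e => f e = i)) => i.
  have [e ei] : exists e, e \in edges_of c i.
    apply/set0Pn; rewrite -(imset_eq0 val) val_edges_of.
    by rewrite cycle_edges_neq0 // (ltn_trans _ (c_size i)).
  by exists e; apply/eqP; rewrite fE.
have [gamma [gamma_i gammaN]] := exists_blockwise_labelling A a f r Ginf Afin rK.
exists gamma => C; split=> [[Ccyc CA]|[i ->]]; last first.
  split; first exact: edges_of_cycle.
  by rewrite /value -(eq_bigl _ _ (fun e => fE e i)) gamma_i.
case: (pickP (fun i => edges_of c i \subset C)) => [i iC|nC].
  by exists i; apply: edges_of_maximal.
case: (gammaN C _ _ CA) => [|i].
  have [d [sd _ vC]] := Ccyc; rewrite -(imset_eq0 val) vC.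
  by rewrite -/(cycle_edges d) cycle_edges_neq0 // (ltn_trans _ sd).
have /negbT/subsetPn[e ei eC] := nC i; exists e => //.
by apply/eqP; rewrite fE.
Qed.

End EdgeDisjointCycles.

(** * Cycles sharing a vertex for each small set of indices *)

Section DesignCycles.

Context (N s : nat).
Hypotheses (N_gt1 : (1 < N)%N) (s_gt1 : (1 < s)%N).

(** Allowing fewer than [s] elements provides the blocks [{i}] and [{i, j}] at once, hence at least
    four vertices on each cycle. *)
Definition blocks (i : 'I_N) : {set {set 'I_N}} :=
  [set B : {set 'I_N} | (i \in B) && (#|B| <= s)%N].

(* The vertex [(B, None)] is shared by all cycles [i \in B], and [(B, Some i)]
   is the private vertex following it on cycle [i]. *)
Definition design_cycle (i : 'I_N) : seq ({set 'I_N} * option 'I_N) :=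
  [seq (B, o) | B <- enum (blocks i), o <- [:: None; Some i]].

Lemma mem_design_cycle i v :
  (v \in design_cycle i) =
  [&& i \in v.1, (#|v.1| <= s)%N & v.2 \in [:: None; Some i]].
Proof.
apply/allpairsP/and3P => [[[B o] /= [+ oi ->]]|[iv vs vi]].
  by rewrite mem_enum inE => /andP[].
by exists v; rewrite mem_enum inE iv vs vi -surjective_pairing.
Qed.

Lemma design_cycle_uniq i : uniq (design_cycle i).
Proof. by apply: allpairs_uniq; rewrite ?enum_uniq // => -[? ?] [? ?]. Qed.

Lemma design_cycle_size i : (2 < size (design_cycle i))%N.
Proof.
suff blocks_gt1: (1 < #|blocks i|)%N.
  by rewrite size_allpairs -cardE (@leq_trans (2 * 2)) // leq_mul2r.
have [j ji] : exists j : 'I_N, j != i.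
  have /card_gt1P[x [y [_ _ xy]]] : (1 < #|'I_N|)%N by rewrite card_ord.
  by case: (eqVneq x i) => [<-|xi]; [exists y; rewrite eq_sym | exists x].
apply/card_gt1P; exists [set i], [set i; j]; rewrite !inE !eqxx cards1 cards2.
rewrite (ltnW s_gt1) (leq_ltn_trans _ s_gt1) ?leq_b1 //; split=> //.
by apply: contra ji => /eqP/setP/(_ j); rewrite !inE eqxx orbT => ->.
Qed.

Definition private_alternation (i : 'I_N) : rel ({set 'I_N} * option 'I_N) :=
  fun x y => [|| (x.2 == None) && (y.2 == Some i) | (x.2 == Some i) && (y.2 == None)].

Lemma design_cycle_alternates i : cycle (private_alternation i) (design_cycle i).
Proof.
rewrite /design_cycle; case: (enum _) => // B l /=.
rewrite rcons_path /private_alternation /= !eqxx /=.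
(* The last vertex is tracked as well, to close the path into a cycle. *)
suff alt x : x.2 = Some i ->
    let p := [seq (B, o) | B <- l, o <- [:: None; Some i]] in
    path (private_alternation i) x p && ((last x p).2 == Some i).
  by have /andP[-> /eqP->] := alt (B, Some i) erefl; rewrite eqxx.
elim: l x => [|B' l IH] x xi /=; first by rewrite xi eqxx.
by rewrite /private_alternation /= xi !eqxx /=; apply: IH.
Qed.

(** Shared and private vertices alternate, so every edge has exactly one private end, whose tag
    names the cycle. *)
Lemma design_cycle_edge_disjoint i j e :
  e \in cycle_edges (design_cycle i) -> e \in cycle_edges (design_cycle j) ->
  i = j.
Proof.
suff priv k e' : e' \in cycle_edges (design_cycle k) ->
    (exists2 v, v \in e' & v.2 = Some k) /\
    (forall v l, v \in e' -> v.2 = Some l -> l = k).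
  by case/priv=> [[v ve vi] _] /priv[_] /(_ v i ve vi).
case/imsetP=> x xc ->; have := next_cycle (design_cycle_alternates k) xc.
case/orP=> /andP[/eqP x2 /eqP n2]; split.
- by exists (next (design_cycle k) x); rewrite ?set22.
- by move=> v l /set2P[]->; rewrite ?x2 ?n2 // => -[].
- by exists x; rewrite ?set21.
- by move=> v l /set2P[]->; rewrite ?x2 ?n2 // => -[].
Qed.

End DesignCycles.

Theorem theorem1p4 (Gamma : zmodType) (A : set Gamma) (s t : nat)
    (Gamma_infinite : infinite_set [set: Gamma]%classic)
    (A_finite : finite_set A) (A_nonempty : nonempty A)
    (s_ge2 : (2 <= s)%N) (t_ge1 : (1 <= t)%N) :
  exists (G : sgraph) (gamma : labelling Gamma G),
    (forall F : {set {set edge G}},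
        #|F| = s -> (forall C, C \in F -> A_cycle A gamma C) ->
        exists v : G, forall C, C \in F -> v \in vertices_of C) /\
    (forall X : {set G}, (#|X| <= t)%N -> ~ hitting_set (A_cycle A gamma) X).
Proof.
pose N := (t * s).+1; pose c := design_cycle N s.
have N_gt1 : (1 < N)%N by rewrite ltnS muln_gt0 t_ge1 ltnW.
have c_uniq : forall i, uniq (c i) := @design_cycle_uniq N s.
have c_size := design_cycle_size N s N_gt1 s_ge2 : forall i, (2 < size (c i))%N.
have c_disj := @design_cycle_edge_disjoint N s : forall i j e,
  e \in cycle_edges (c i) -> e \in cycle_edges (c j) -> i = j.
have [gamma gammaP] := exists_cycles_labelling c c_uniq c_size c_disj A
  Gamma_infinite A_finite A_nonempty.
have inj := edges_of_inj c c_uniq c_size c_disj.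
have memV := mem_vertices_of_edges_of c c_uniq c_size.
exists (cycles_graph c), gamma; split=> [F Fs FA|X Xt hitX].
  pose B := [set i | edges_of c i \in F].
  exists ((B, None) : cycles_graph c) => C CF.
  have [i Ci] := (gammaP C).1 (FA C CF).
  (* As [edges_of] is injective, [B] has at most [#|F| = s] elements and so is a block. *)
  rewrite Ci memV mem_design_cycle /= inE -Ci CF /= andbT -Fs.
  rewrite -(card_imset _ inj); apply/subset_leq_card/fintype.subsetP => _ /imsetP[j + ->].
  by rewrite inE.
(* A vertex whose first component has more than [s] elements lies on no cycle, so it contributes the
   empty set. *)
have XN : [set: 'I_N]%SET \subset
    \bigcup_(v in X) (if (#|v.1| <= s)%N then v.1 else finset.set0).
  apply/fintype.subsetP => i _.
  have [v vX] := hitX _ ((gammaP _).2 (ex_intro _ i erefl)).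
  rewrite memV mem_design_cycle => /and3P[iv vs _].
  by apply/bigcupP; exists v; rewrite // vs.
have: (N <= t * s)%N.
  rewrite -[N]card_ord -cardsT (leq_trans (subset_leq_card XN)) //.
  rewrite (leq_trans _ (leq_mul Xt (leqnn s))) // -sum_nat_const.
  elim/big_rec2: _ => [|v m U _ Um]; first by rewrite cards0.
  rewrite (leq_trans (leq_card_setU _ _)) // leq_add //.
  by case: ifP; rewrite ?cards0.
by rewrite ltnn.
Qed.
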